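(* Let $(Z,\rho)$ be a compact metric space, let $X$ be a closed non-empty subset of $Z$ with the restricted metric, let $n$ be a positive integer, let $A=C(X)$ and $B=C(Z)$ (continuous complex-valued functions), and let $\pi:M_n(B)\to M_n(A)$ be restriction of functions from $Z$ to $X$. Let $T$ be a compact space and let $p:T\to M_n(A)$ be a continuous function such that $p_t$ is a projection for each $t$. Assume that there is a constant $N$ such that $L(p_t)\le N$ for all $t$. Suppose that $X$ is $\varepsilon$-dense in $Z$. If $\varepsilon\lambda_nN<1/12$, then there exists a continuous function $q:T\to M_n(B)$ such that $q_t$ is a projection, $\pi(q_t)=p_t$, and $$L(q_t)< \lambda_nN(1-12\varepsilon\lambda_nN)^{-1}$$ for each $t\in T$. If, instead, $A=C_{\mathbb R}(X)$ and $B=C_{\mathbb R}(Z)$ (continuous real-valued functions), one has the same conclusions.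
   Context: For a compact metric space $(W,\rho)$, $M_n(C(W))$ is viewed as the algebra of continuous functions from $W$ to $M_n(\mathbb C)$ (with the operator norm on $\mathbb C^n$), with norm $\|a\|=\sup_w\|a(w)\|$ and pointwise adjoint. The Lipschitz seminorm is $L(a)=\sup\{\|a(x)-a(y)\|/\rho(x,y):x\neq y\}\in[0,\infty]$, and similarly over $\mathbb R$. A projection is an element $p$ with $p=p^2=p^*$. $X$ is $\varepsilon$-dense in $Z$ if every element of $Z$ is within distance $\varepsilon$ of some point of $X$ (that is, at distance $\le\varepsilon$). Let $M_n^s(\mathbb C)$ be the real Banach space of self-adjoint $n\times n$ matrices with the operator norm. For a function $F$ on $X\times T$ write $F_t$ for $x\mapsto F(x,t)$. The constant $\lambda_n$ is the smallest constant $c$ such that for every compact metric space $Z$, every closed subset $X$ of $Z$, every compact space $T$, and every continuous $F:X\times T\to M_n^s(\mathbb C)$ for which there is a constant $N$ with $L(F_t)\le N$ for all $t$, there is a continuous extension $G:Z\times T\to M_n^s(\mathbb C)$ of $F$ with $L(G_t)\le cN$ for all $t$ and $\|G\|_\infty=\|F\|_\infty$. (The same $\lambda_n$ is used in the real case.)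
   Formalization: The formal theorem assumes N > 0 and ε > 0: for N = 0 the strict bound would read L(q_t) < 0, and for ε = 0 (so X = Z, q = p) it would read L(p_t) < λ_n N, which fails for n = 1 and the indicator of one of two points. *)

(* Defs.v *)
From HB Require Import structures.
From mathcomp Require Import all_boot all_order all_algebra.
From mathcomp Require Import all_classical all_reals all_analysis.
From mathcomp Require Export complex.

Set Implicit Arguments.
Unset Strict Implicit.
Unset Printing Implicit Defensive.

Import Order.TTheory GRing.Theory Num.Theory.
Import numFieldNormedType.Exports.

Local Open Scope classical_set_scope.
Local Open Scope ring_scope.
Local Open Scope complex_scope.
Local Open Scope sesquilinear_scope.

(* The scalars K are R or R[i]; [m] is the modulus K -> R.  The supremum norm
   and the Lipschitz seminorm take their values in [0, +oo]: 0 is added to the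
   sets below so that the supremum of an empty family is 0 and not -oo. *)
Section MatrixFunctions.
Context {R : realType} {K : pzRingType} (m : K -> R) {n : nat}.

Definition enorm (v : 'cV[K]_n) : R := Num.sqrt (\sum_(i < n) m (v i 0) ^+ 2).

Definition opnorm (a : 'M[K]_n) : R :=
  sup [set enorm (a *m v) | v in [set v | enorm v <= 1]].

Definition supnorm {W : Type} (D : set W) (a : W -> 'M[K]_n) : \bar R :=
  ereal_sup (0%E |` [set (opnorm (a w))%:E | w in D]).

Definition lip {W : metricType R} (D : set W) (a : W -> 'M[K]_n) : \bar R :=
  ereal_sup (0%E |` [set (opnorm (a xy.1 - a xy.2) / mdist xy.1 xy.2)%:E
                    | xy in [set xy | [/\ D xy.1, D xy.2 & xy.1 != xy.2]]]).

(* Continuity on the subspace D, for the operator norm topology of 'M[K]_n. *)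
Definition cont_on {W : topologicalType} (D : set W) (a : W -> 'M[K]_n) :=
  forall w, D w -> opnorm (a v - a w) @[v --> within D (nbhs w)] --> (0 : R).

(* A continuous function T -> M_n(C(D)), where M_n(C(D)) carries the supremum
   norm.  An element of M_n(C(D)) is given by a function on the ambient space
   W, of which only the restriction to D matters. *)
Definition cont_family {T W : topologicalType} (D : set W)
    (p : T -> W -> 'M[K]_n) :=
  (forall t, cont_on D (p t)) /\
  (forall s, supnorm D (fun x => p t x - p s x) @[t --> s] --> 0%E).

End MatrixFunctions.

Definition modC {R : realType} (z : R[i]) : R := Normc.normc z.

Definition modR {R : realType} (x : R) : R := `|x|.

Definition dense_within {R : realType} {Z : metricType R} (X : set Z) (e : R) :=
  forall z, exists2 x, X x & mdist z x <= e.

Definition projectionC {R : realType} {n} (a : 'M[R[i]]_n) :=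
  a *m a = a /\ a ^t* = a.

Definition projectionR {R : realType} {n} (a : 'M[R]_n) :=
  a *m a = a /\ a^T = a.

Definition extension_constant (R : realType) (n : nat) (c : R) : Prop :=
  forall (Z : metricType R) (X : set Z) (T : topologicalType)
    (F : Z * T -> 'M[R[i]]_n) (N : R),
  compact [set: Z] -> closed X -> compact [set: T] ->
  (forall x t, X x -> F (x, t) ^t* = F (x, t)) ->
  cont_on modC (X `*` [set: T]) F ->
  (forall t, (lip modC X (fun x => F (x, t)) <= N%:E)%E) ->
  exists G : Z * T -> 'M[R[i]]_n,
    [/\ forall z t, G (z, t) ^t* = G (z, t),
        cont_on modC [set: Z * T] G,
        forall x t, X x -> G (x, t) = F (x, t),
        forall t, (lip modC [set: Z] (fun z => G (z, t)) <= (c * N)%:E)%E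
      & supnorm modC [set: Z * T] G = supnorm modC (X `*` [set: T]) F].

Definition is_lambda (R : realType) (n : nat) (lambda : R) : Prop :=
  extension_constant n lambda /\
  (forall c : R, extension_constant n c -> lambda <= c).

(* Main.v *)
Require Import Defs.
From HB Require Import structures.
From mathcomp Require Import all_boot all_order all_algebra.
From mathcomp Require Import all_classical all_reals all_analysis.
From mathcomp Require Import ring lra.

Set Implicit Arguments.
Unset Strict Implicit.
Unset Printing Implicit Defensive.

Import Order.TTheory GRing.Theory Num.Theory.
Import numFieldNormedType.Exports.

Local Open Scope classical_set_scope.
Local Open Scope ring_scope.
Local Open Scope complex_scope.
Local Open Scope sesquilinear_scope.

(** The defining property of [lambda], applied to [p] seen as a function on
    [X * T], gives a self-adjoint extension [G] over [Z * T] with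
    [L (G_t) <= lambda N].  Since [X] is [eps]-dense, every value [a] of [G]
    lies within [d = eps lambda N < 1/12] of some projection, a value of [p].
    So the eigenvalues of [a] lie within [d] of 0 or 1, and [q] is obtained
    from [G] by rounding them to 0 or 1, that is, by replacing [a] with its
    spectral projection near 1.

    Rounding costs only a factor [1 / (1 - 2 d)] in the Lipschitz constant.
    Let [P] and [Q] be the spectral projections of [a] and [b].  The corner
    [X = P (1 - Q)] solves [a X - X b = P (a - b) (1 - Q)], where [a] acts on
    the range of [P] as a [d]-perturbation of the identity and [b] on the range
    of [1 - Q] as a [d]-perturbation of zero; hence
    [|X| (1 - 2 d) <= |a - b|] (opnorm_spectral_corner).  The same holds for
    [(1 - P) Q], and [|P - Q|] is bounded by the larger of the two corners
    (opnorm_sub_projections).  This global estimate (spectral_projection_lip)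
    gives at once that [q] is continuous, that the spectral projection is
    unique, so that [q] agrees with [p] on [X], and that
    [L (q_t) <= lambda N / (1 - 2 d)].  The last bound is strictly smaller than
    [lambda N / (1 - 12 d)] because [lambda > 0] (extension_constant_gt0).

    In the real case the extension [G] of the complexified family may fail to
    be real; its entrywise real part is an extension with the same properties,
    as taking real parts is a linear contraction for the operator norm.
    Uniqueness of the spectral projection shows that rounding commutes with
    complex conjugation, so the rounded family is real. *)

(** * The operator norm over a valued ring *)

Section SumOfSquares.
Context {R : realType} (I : finType).
Implicit Types f g : I -> R.

Lemma cauchy_schwarz f g :
  \sum_i f i * g i <=
  Num.sqrt (\sum_i f i ^+ 2) * Num.sqrt (\sum_i g i ^+ 2).
Proof.
set A := \sum_i f i ^+ 2; set B := \sum_i g i ^+ 2.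
have A0 : 0 <= A by apply: sumr_ge0 => i _; exact: sqr_ge0.
have B0 : 0 <= B by apply: sumr_ge0 => i _; exact: sqr_ge0.
have null (h k : I -> R) : \sum_i h i ^+ 2 = 0 -> \sum_i h i * k i = 0.
  move=> /eqP; rewrite psumr_eq0 => [|i _]; last exact: sqr_ge0.
  move=> /allP h0; apply: big1 => i _.
  have := h0 i (mem_index_enum i).
  by rewrite /= sqrf_eq0 => /eqP ->; rewrite mul0r.
have [Az|An] := eqVneq A 0.
  by rewrite (null f g Az) mulr_ge0// sqrtr_ge0.
have [Bz|Bn] := eqVneq B 0.
  rewrite (eq_bigr (fun i => g i * f i)) => [|i _]; last exact: mulrC.
  by rewrite (null g f Bz) mulr_ge0// sqrtr_ge0.
set a := Num.sqrt A; set b := Num.sqrt B.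
have a0 : 0 < a by rewrite sqrtr_gt0 lt_def An.
have b0 : 0 < b by rewrite sqrtr_gt0 lt_def Bn.
(* Up to the factor 2 a b, this sum of squares is the difference of the two
   sides. *)
have : 0 <= \sum_i (f i * b - g i * a) ^+ 2.
  by apply: sumr_ge0 => i _; exact: sqr_ge0.
have -> : \sum_i (f i * b - g i * a) ^+ 2 =
    2%:R * (a * b) * (a * b - \sum_i f i * g i).
  rewrite (eq_bigr (fun i => b ^+ 2 * f i ^+ 2 + a ^+ 2 * g i ^+ 2
                             - 2%:R * (a * b) * (f i * g i))); last first.
    by move=> i _; ring.
  rewrite sumrB big_split /= -!mulr_sumr -/A -/B !sqr_sqrtr //.
  by rewrite -[A]sqr_sqrtr // -[B]sqr_sqrtr // -/a -/b; ring.
by rewrite pmulr_rge0 ?mulr_gt0 // subr_ge0.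
Qed.

Lemma minkowski f g :
  Num.sqrt (\sum_i (f i + g i) ^+ 2) <=
  Num.sqrt (\sum_i f i ^+ 2) + Num.sqrt (\sum_i g i ^+ 2).
Proof.
rewrite -(@ler_pXn2r _ 2) // ?nnegrE ?addr_ge0 ?sqrtr_ge0 //.
rewrite sqrrD !sqr_sqrtr ?sumr_ge0 // => [|i _|i _|i _]; rewrite ?sqr_ge0 //.
rewrite (eq_bigr (fun i => f i ^+ 2 + (f i * g i) *+ 2 + g i ^+ 2)) => [|i _].
  by rewrite !big_split /= lerD2r lerD2l -mulr2n lerMn2r cauchy_schwarz.
by rewrite sqrrD.
Qed.

End SumOfSquares.

(** The map [c] provides a scalar of each modulus.  Vectors are rescaled with
    it, which turns a bound on the unit ball into a bound on every vector.
    The properties are those shared by the real and the complex modulus. *)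
Definition valued_by {R : realType} {K : comPzRingType} (m : K -> R)
    (c : R -> K) :=
  [/\ forall x, 0 <= m x, forall x y, m (x * y) = m x * m y,
      forall x y, m (x + y) <= m x + m y, forall x, m (- x) = m x
    & forall r, m (c r) = `|r|].

Section OperatorNorm.
Context {R : realType} {K : comPzRingType} {m : K -> R} {c : R -> K}.
Hypothesis mP : valued_by m c.

Lemma valued_ge0 x : 0 <= m x. Proof. by case: mP. Qed.
Lemma valuedM x y : m (x * y) = m x * m y. Proof. by case: mP. Qed.
Lemma valuedD x y : m (x + y) <= m x + m y. Proof. by case: mP. Qed.
Lemma valuedN x : m (- x) = m x. Proof. by case: mP. Qed.
Lemma valued_scal r : m (c r) = `|r|. Proof. by case: mP. Qed.

Lemma valued0 : m 0 = 0.
Proof. by rewrite -(mul0r (c 0)) valuedM valued_scal normr0 mulr0. Qed.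

Lemma valued_sum (I : finType) (F : I -> K) :
  m (\sum_i F i) <= \sum_i m (F i).
Proof.
elim/big_ind2: _ => [|x1 x2 y1 y2 xy1 xy2|//]; first by rewrite valued0.
exact: le_trans (valuedD _ _) (lerD _ _).
Qed.

Section Dimension.
Context {n : nat}.
Implicit Types (u v : 'cV[K]_n) (a b : 'M[K]_n).

Lemma enorm_ge0 v : 0 <= enorm m v. Proof. exact: sqrtr_ge0. Qed.

Lemma enorm_sqr v : enorm m v ^+ 2 = \sum_i m (v i 0) ^+ 2.
Proof. by rewrite sqr_sqrtr // sumr_ge0 // => i _; exact: sqr_ge0. Qed.

Lemma enorm0 : enorm m (0 : 'cV_n) = 0.
Proof.
by rewrite /enorm big1 ?sqrtr0 // => i _; rewrite mxE valued0 expr0n.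
Qed.

Lemma enormZ k v : enorm m (k *: v) = m k * enorm m v.
Proof.
rewrite /enorm (eq_bigr (fun i => m k ^+ 2 * m (v i 0) ^+ 2)) => [|i _].
  by rewrite -mulr_sumr sqrtrM ?sqr_ge0 // sqrtr_sqr ger0_norm // valued_ge0.
by rewrite mxE valuedM exprMn.
Qed.

Lemma enormN v : enorm m (- v) = enorm m v.
Proof. by rewrite /enorm; under eq_bigr do rewrite mxE valuedN. Qed.

Lemma enormD u v : enorm m (u + v) <= enorm m u + enorm m v.
Proof.
apply: le_trans (minkowski _ _); rewrite ler_sqrt; last first.
  by apply: sumr_ge0 => i _; exact: sqr_ge0.
apply: ler_sum => i _; rewrite ler_pXn2r ?nnegrE ?addr_ge0 ?valued_ge0 //.
by rewrite mxE valuedD.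
Qed.

Lemma entry_le_enorm v i : m (v i 0) <= enorm m v.
Proof.
rewrite -[leLHS]ger0_norm ?valued_ge0// -sqrtr_sqr ler_sqrt; last first.
  by apply: sumr_ge0 => j _; exact: sqr_ge0.
by rewrite (bigD1 i) //= lerDl sumr_ge0 // => j _; exact: sqr_ge0.
Qed.

Lemma enorm_le_sum v : enorm m v <= \sum_i m (v i 0).
Proof.
have S0 : 0 <= \sum_i m (v i 0) by apply: sumr_ge0 => i _; exact: valued_ge0.
rewrite -(@ler_pXn2r _ 2) // ?nnegrE ?enorm_ge0 // enorm_sqr expr2 mulr_suml.
apply: ler_sum => i _; rewrite expr2 ler_wpM2l ?valued_ge0 //.
by rewrite (bigD1 i) //= lerDl sumr_ge0 // => j _; exact: valued_ge0.
Qed.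

(** A crude bound, whose purpose is to make the supremum that defines the
    operator norm finite. *)
Lemma mulmx_bounded a :
  exists2 s, 0 <= s & forall v, enorm m (a *m v) <= s * enorm m v.
Proof.
exists (\sum_i \sum_j m (a i j)) => [|v].
  by apply: sumr_ge0 => i _; apply: sumr_ge0 => j _; exact: valued_ge0.
apply: le_trans (enorm_le_sum _) _; rewrite mulr_suml; apply: ler_sum => i _.
rewrite mxE mulr_suml; apply: le_trans (valued_sum _) _; apply: ler_sum => j _.
by rewrite valuedM ler_wpM2l ?valued_ge0 ?entry_le_enorm.
Qed.

Lemma opnorm_has_sup a :
  has_sup [set enorm m (a *m v) | v in [set v | enorm m v <= 1]].
Proof.
split; first by exists (enorm m (a *m 0)), 0 => //=; rewrite enorm0 ler01.
have [s s0 sP] := mulmx_bounded a; exists s => _ [v /= v1 <-].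
by apply: le_trans (sP v) _; rewrite ler_piMr.
Qed.

Lemma opnorm_mulmx a v : enorm m (a *m v) <= opnorm m a * enorm m v.
Proof.
have [v0|vn0] := eqVneq (enorm m v) 0.
  (* Such a vector cannot be rescaled, but the crude bound applies to it. *)
  by have [s _ /(_ v)] := mulmx_bounded a; rewrite v0 !mulr0.
have v_gt0 : 0 < enorm m v by rewrite lt_def vn0 enorm_ge0.
pose w := c (enorm m v)^-1 *: v.
have wE u : enorm m (c (enorm m v)^-1 *: u) = enorm m u / enorm m v.
  by rewrite enormZ valued_scal ger0_norm ?invr_ge0 ?enorm_ge0 // mulrC.
rewrite -ler_pdivrMr // -wE scalemxAr; apply: sup_upper_bound.
  exact: opnorm_has_sup.
by exists w => //=; rewrite wE divff.
Qed.

Lemma opnorm_le a s : 0 <= s ->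
  (forall v, enorm m (a *m v) <= s * enorm m v) -> opnorm m a <= s.
Proof.
move=> s0 sP; apply: ge_sup; first by have [] := opnorm_has_sup a.
by move=> _ [v /= v1 <-]; apply: le_trans (sP v) _; rewrite ler_piMr.
Qed.

Lemma opnorm_ge0 a : 0 <= opnorm m a.
Proof.
apply: le_trans (enorm_ge0 (a *m 0)) _; apply: sup_upper_bound.
  exact: opnorm_has_sup.
by exists 0 => //=; rewrite enorm0 ler01.
Qed.

Lemma opnorm0 : opnorm m (0 : 'M[K]_n) = 0.
Proof.
apply/eqP; rewrite eq_le opnorm_ge0 andbT; apply: opnorm_le => // v.
by rewrite mul0mx enorm0 mul0r.
Qed.

Lemma opnorm_eq0 a : opnorm m a = 0 -> (forall x, m x = 0 -> x = 0) -> a = 0.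
Proof.
move=> a0 m_eq0; apply/matrixP => i j; rewrite mxE; apply: m_eq0.
apply/eqP; rewrite eq_le valued_ge0 andbT.
have -> : a i j = (a *m delta_mx j 0 : 'cV_n) i 0 by rewrite -colE mxE.
apply: le_trans (entry_le_enorm _ _) _.
by apply: le_trans (opnorm_mulmx _ _) _; rewrite a0 mul0r.
Qed.

Lemma opnormN a : opnorm m (- a) = opnorm m a.
Proof.
rewrite /opnorm; congr (sup _); apply: eq_imagel => v _.
by rewrite mulNmx enormN.
Qed.

Lemma opnormD a b : opnorm m (a + b) <= opnorm m a + opnorm m b.
Proof.
apply: opnorm_le => [|v]; first by rewrite addr_ge0 ?opnorm_ge0.
rewrite mulmxDl mulrDl; apply: le_trans (enormD _ _) _.
by rewrite lerD // opnorm_mulmx.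
Qed.

Lemma opnorm_distC a b : opnorm m (a - b) = opnorm m (b - a).
Proof. by rewrite -opnormN opprB. Qed.

Lemma opnorm_triangle b a d :
  opnorm m (a - d) <= opnorm m (a - b) + opnorm m (b - d).
Proof. by apply: le_trans (opnormD _ _); rewrite addrA subrK. Qed.

Lemma opnormM a b : opnorm m (a *m b) <= opnorm m a * opnorm m b.
Proof.
apply: opnorm_le => [|v]; first by rewrite mulr_ge0 ?opnorm_ge0.
rewrite -mulmxA -mulrA; apply: le_trans (opnorm_mulmx _ _) _.
by rewrite ler_wpM2l ?opnorm_ge0 ?opnorm_mulmx.
Qed.

End Dimension.

(** * Lipschitz seminorm and continuity in terms of bounds *)

Section Functions.
Context {n : nat}.

Lemma supnorm_leP (W : Type) (D : set W) (a : W -> 'M[K]_n) (s : R) :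
  0 <= s ->
  (supnorm m D a <= s%:E)%E <-> forall w, D w -> opnorm m (a w) <= s.
Proof.
move=> s0; split=> [sup_le w Dw|sP].
  rewrite -lee_fin; apply: le_trans sup_le; apply: ereal_sup_ubound.
  by right; exists w.
by apply: ge_ereal_sup => _ [->|[w Dw <-]]; rewrite lee_fin ?s0 ?sP.
Qed.

Lemma lip_leP (W : metricType R) (D : set W) (a : W -> 'M[K]_n) (s : R) :
  0 <= s ->
  (lip m D a <= s%:E)%E <->
  forall x y, D x -> D y -> opnorm m (a x - a y) <= s * mdist x y.
Proof.
move=> s0; split=> [sup_le x y Dx Dy|sP].
  have [->|xy] := eqVneq x y; first by rewrite subrr opnorm0 mulr_ge0 ?mdist_ge0.
  rewrite -ler_pdivrMr ?mdist_gt0 // -lee_fin; apply: le_trans sup_le.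
  by apply: ereal_sup_ubound; right; exists (x, y).
apply: ge_ereal_sup => _ [->|[[x y] /= [Dx Dy xy] <-]]; rewrite lee_fin //.
by rewrite ler_pdivrMr ?mdist_gt0 ?sP.
Qed.

Lemma cont_onP (W : topologicalType) (D : set W) (a : W -> 'M[K]_n) :
  cont_on m D a <->
  forall w, D w -> forall e, 0 < e ->
    \forall v \near w, D v -> opnorm m (a v - a w) <= e.
Proof.
split=> [ca w Dw e e0|ca w Dw].
  have /cvgrPdist_le/(_ e e0) := ca w Dw.
  rewrite near_withinE; apply: filterS => v dv /dv.
  by rewrite sub0r normrN ger0_norm ?opnorm_ge0.
apply/cvgrPdist_le => e e0; rewrite near_withinE.
apply: filterS (ca w Dw e e0) => v dv /dv.
by rewrite sub0r normrN ger0_norm ?opnorm_ge0.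
Qed.

Lemma supnorm_cvg0P (T : topologicalType) (W : Type) (D : set W) (s : T)
    (a : T -> W -> 'M[K]_n) :
  supnorm m D (a t) @[t --> s] --> 0%E <->
  forall e, 0 < e ->
    \forall t \near s, forall w, D w -> opnorm m (a t w) <= e.
Proof.
have sup_ge0 t : (0 <= supnorm m D (a t))%E.
  by apply: ereal_sup_ubound; left.
split=> [ca e e0|ca].
  have : nbhs (0%E : \bar R) [set x | (x < e%:E)%E].
    apply: open_nbhs_nbhs; split; last by rewrite /= lte_fin.
    exact: open_ereal_lt_ereal.
  move=> /ca lt_e; have {lt_e} : \forall t \near s, (supnorm m D (a t) < e%:E)%E.
    exact: lt_e.
  by apply: filterS => t /ltW/(supnorm_leP _ _ (ltW e0)).
have sup_le e : 0 < e -> \forall t \near s, (supnorm m D (a t) <= e%:E)%E.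
  by move=> e0; apply: filterS (ca e e0) => t /(supnorm_leP _ _ (ltW e0)).
(* Convergence to a real number is convergence of the finite parts, once the
   supremum norms are known to be eventually finite. *)
apply/fine_cvgP; split.
  apply: filterS (sup_le 1 ltr01) => t le1.
  by rewrite fin_numElt (lt_le_trans _ (sup_ge0 t)) // (le_lt_trans le1) // ltry.
apply/cvgrPdist_le => e e0; apply: filterS (sup_le e e0) => t.
move: (sup_ge0 t); rewrite /comp; case: (supnorm m D (a t)) => [r| |] //=.
by rewrite !lee_fin sub0r normrN => r0 re; rewrite ger0_norm.
Qed.

End Functions.
End OperatorNorm.

(** * Orthogonality and projections in complex matrices *)

Section Complex.
Context {R : realType}.
Local Notation C := R[i].
Local Notation modC := (@modC R).

Lemma modC_valued : valued_by modC (real_complex R).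
Proof.
split=> [x|x y|x y|x|r].
- rewrite -lecR; exact: (normr_ge0 x).
- exact: Normc.normcM.
- rewrite -lecR rmorphD; exact: (ler_normD x y).
- by case: x => p q; rewrite /Defs.modC /= !sqrrN.
- by rewrite /Defs.modC /= expr0n addr0 sqrtr_sqr.
Qed.

Lemma modR_valued : valued_by (@modR R) idfun.
Proof.
by split=> [x|x y|x y|x|r]; rewrite /modR ?normrM ?normrN ?ler_normD.
Qed.

Lemma modC_conj (z : C) : modC (Num.conj z) = modC z.
Proof. by case: z => p q; rewrite /Defs.modC /= sqrrN. Qed.

Local Notation vP := modC_valued.

Section Dimension.
Context {n : nat}.
Implicit Types (u v w : 'cV[C]_n) (a b P Q U V : 'M[C]_n).

Lemma trmxC_mul m p q (A : 'M[C]_(m, p)) (B : 'M[C]_(p, q)) :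
  (A *m B) ^t* = B ^t* *m A ^t*.
Proof. by rewrite trmx_mul map_mxM. Qed.

Lemma trmxC_add m p (A B : 'M[C]_(m, p)) : (A + B) ^t* = A ^t* + B ^t*.
Proof. by apply/matrixP => i j; rewrite !mxE rmorphD. Qed.

Lemma trmxC_sub m p (A B : 'M[C]_(m, p)) : (A - B) ^t* = A ^t* - B ^t*.
Proof. by apply/matrixP => i j; rewrite !mxE rmorphB. Qed.

Lemma map_conjK m p (A : 'M[C]_(m, p)) :
  map_mx Num.conj (map_mx Num.conj A) = A.
Proof. by apply/matrixP => i j; rewrite !mxE conjCK. Qed.

Lemma enorm_sqr_dot v : ((enorm modC v ^+ 2)%:C)%C = (v ^t* *m v) 0 0.
Proof.
rewrite enorm_sqr raddf_sum mxE; apply: eq_bigr => i _.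
rewrite !mxE -normCKC; exact: (rmorphXn (real_complex R) 2).
Qed.

Lemma enorm_isometry U v : U ^t* *m U = 1%:M ->
  enorm modC (U *m v) = enorm modC v.
Proof.
move=> UU; apply/eqP; rewrite -(eqrXn2 (n:=2)) ?enorm_ge0 //.
apply/eqP/complexI; rewrite !enorm_sqr_dot trmxC_mul mulmxA.
by rewrite -(mulmxA _ _ U) UU mulmx1.
Qed.

Lemma enorm_pythagoras u v : u ^t* *m v = 0 ->
  enorm modC (u + v) ^+ 2 = enorm modC u ^+ 2 + enorm modC v ^+ 2.
Proof.
move=> uv; have vu : v ^t* *m u = 0.
  by rewrite -[LHS]trmxCK trmxC_mul trmxCK uv trmx0 map_mx0.
apply: complexI; rewrite rmorphD /= !enorm_sqr_dot.
rewrite trmxC_add mulmxDl !mulmxDr uv vu addr0 add0r.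
by rewrite mxE.
Qed.

Lemma projectionC_compl P : projectionC P -> projectionC (1%:M - P).
Proof.
move=> [PP Ps]; split; last by rewrite trmxC_sub Ps trmx1 map_mx1.
by rewrite mulmxBl mul1mx mulmxBr mulmx1 PP subrr subr0.
Qed.

Lemma projection_compl0 P : projectionC P -> P *m (1%:M - P) = 0.
Proof. by move=> [PP _]; rewrite mulmxBr mulmx1 PP subrr. Qed.

Lemma compl_projection0 P : projectionC P -> (1%:M - P) *m P = 0.
Proof. by move=> [PP _]; rewrite mulmxBl mul1mx PP subrr. Qed.

Lemma projection_pythagoras P u v : projectionC P ->
  enorm modC (P *m u + (1%:M - P) *m v) ^+ 2 =
  enorm modC (P *m u) ^+ 2 + enorm modC ((1%:M - P) *m v) ^+ 2.
Proof.
move=> Pp; apply: enorm_pythagoras; rewrite trmxC_mul Pp.2 mulmxA.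
by rewrite -(mulmxA _ P) projection_compl0 // mulmx0 mul0mx.
Qed.

Lemma projection_decomp P v : projectionC P ->
  enorm modC (P *m v) ^+ 2 + enorm modC ((1%:M - P) *m v) ^+ 2 =
  enorm modC v ^+ 2.
Proof.
by move=> Pp; rewrite -projection_pythagoras // -mulmxDl addrC subrK mul1mx.
Qed.

Lemma opnorm_projection_le1 P : projectionC P -> opnorm modC P <= 1.
Proof.
move=> Pp; apply: (opnorm_le vP) => // v; rewrite mul1r.
rewrite -(@ler_pXn2r _ 2) ?nnegrE ?enorm_ge0 //.
by rewrite -(projection_decomp v Pp) lerDl sqr_ge0.
Qed.

(** The two off-diagonal corners of [P - Q] have orthogonal ranges and act on
    orthogonal vectors, so a common bound for them bounds the difference
    without a factor 2. *)
Lemma opnorm_sub_projections P Q s : projectionC P -> projectionC Q -> 0 <= s ->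
  opnorm modC (P *m (1%:M - Q)) <= s -> opnorm modC ((1%:M - P) *m Q) <= s ->
  opnorm modC (P - Q) <= s.
Proof.
move=> Pp Qp s0 PQ QP; apply: (opnorm_le vP) => // v.
have -> : (P - Q) *m v =
    P *m ((1%:M - Q) *m v) + (1%:M - P) *m (- (Q *m v)).
  rewrite mulmxN !mulmxA -mulNmx -mulmxDl; congr (_ *m v).
  by rewrite mulmxBr mulmx1 mulmxBl mul1mx opprB addrA subrK.
rewrite -(@ler_pXn2r _ 2) ?nnegrE ?mulr_ge0 ?enorm_ge0 //.
rewrite projection_pythagoras // mulmxN (enormN vP) exprMn.
rewrite -(projection_decomp v Qp) mulrDr addrC.
have block A B : B *m B = B -> opnorm modC (A *m B) <= s ->
    enorm modC (A *m (B *m v)) ^+ 2 <= s ^+ 2 * enorm modC (B *m v) ^+ 2.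
  move=> BB AB; rewrite -exprMn ler_pXn2r ?nnegrE ?mulr_ge0 ?enorm_ge0 //.
  rewrite -[in leLHS]BB -mulmxA mulmxA; apply: le_trans (opnorm_mulmx vP _ _) _.
  by rewrite ler_wpM2r ?enorm_ge0.
have [Qc _] := projectionC_compl Qp; have [Qq _] := Qp.
apply: lerD; first exact: (block _ _ Qq QP).
exact: (block _ _ Qc PQ).
Qed.

(** * Spectral projections of matrices close to projections *)

(** For a self-adjoint [a] and [d < 1/2], such a [P] is the projection onto
    the span of the eigenvectors of [a] with eigenvalue within [d] of 1, and
    the other eigenvalues are within [d] of 0.  Stated without eigenvalues,
    the notion lets two matrices be compared by algebra alone. *)
Definition spectral_projection (d : R) a P :=
  [/\ projectionC P, P *m a = a *m P & opnorm modC (a - P) <= d].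

(** Exchanges the two corners of [P - Q]. *)
Lemma spectral_projection_compl d a P : spectral_projection d a P ->
  spectral_projection d (1%:M - a) (1%:M - P).
Proof.
move=> [Pp Pa aP]; split; first exact: projectionC_compl.
  by rewrite !mulmxBl !mulmxBr !mul1mx !mulmx1 Pa !opprB
     addrACA [RHS]addrACA [- a + _]addrC.
by rewrite opprB [_ + (P - _)]addrC addrA subrK (opnorm_distC vP).
Qed.

Lemma gap_gt0 (d : R) : d < 2%:R^-1 -> 0 < 1 - 2%:R * d.
Proof. by move=> d2; rewrite subr_gt0 -ltr_pdivlMl ?ltr0n // mulr1. Qed.

(** With [X = P (1 - Q)] one has [a X = X + (a - P) X] and [X b = X (b - Q)],
    so the Sylvester equation [a X - X b = P (a - b) (1 - Q)] bounds [X]. *)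
Lemma opnorm_spectral_corner d a b P Q : d < 2%:R^-1 ->
  spectral_projection d a P -> spectral_projection d b Q ->
  opnorm modC (P *m (1%:M - Q)) <= opnorm modC (a - b) / (1 - 2%:R * d).
Proof.
move=> d2 [Pp Pa aP] [Qp Qb bQ].
have gap := gap_gt0 d2.
set X := P *m (1%:M - Q).
have Pc : P *m X = X by rewrite /X mulmxA Pp.1.
have XQ : X *m Q = 0 by rewrite /X -mulmxA compl_projection0 // mulmx0.
have XE : X = P *m (a - b) *m (1%:M - Q) - (a - P) *m X + X *m (b - Q).
  have -> : P *m (a - b) *m (1%:M - Q) = a *m X - X *m b.
    rewrite [P *m (a - b)]mulmxBr mulmxBl Pa /X -!mulmxA.
    congr (_ - P *m _).
    by rewrite mulmxBl mulmxBr mul1mx mulmx1 Qb.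
  by rewrite mulmxBl mulmxBr XQ Pc subr0 opprB addrAC subrK addrC subrK.
have P1 := opnorm_projection_le1 Pp.
have Q1 := opnorm_projection_le1 (projectionC_compl Qp).
have Pab : opnorm modC (P *m (a - b)) <= opnorm modC (a - b).
  apply: le_trans (opnormM vP _ _) _; rewrite -[leRHS]mul1r.
  exact: (ler_wpM2r (opnorm_ge0 vP _) P1).
have: opnorm modC X <=
    opnorm modC (a - b) + d * opnorm modC X + opnorm modC X * d.
  rewrite {1}XE; apply: le_trans (opnormD vP _ _) _; apply: lerD; last first.
    apply: le_trans (opnormM vP _ _) _.
    exact: (ler_wpM2l (opnorm_ge0 vP _) bQ).
  apply: le_trans (opnormD vP _ _) _; apply: lerD; last first.
    rewrite (opnormN vP); apply: le_trans (opnormM vP _ _) _.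
    exact: (ler_wpM2r (opnorm_ge0 vP _) aP).
  apply: le_trans (opnormM vP _ _) _; rewrite -[leRHS]mulr1.
  exact: (ler_pM (opnorm_ge0 vP _) (opnorm_ge0 vP _) Pab Q1).
by rewrite ler_pdivlMr // mulrBr mulr1 lerBlDr mulrCA mulr_natl mulr2n addrA
  [d * _]mulrC.
Qed.

(** The spectral projection is a Lipschitz function of the matrix, on all
    pairs of matrices and not only on nearby ones: no path from [a] to [b] is
    followed. *)
Lemma spectral_projection_lip d a b P Q : d < 2%:R^-1 ->
  spectral_projection d a P -> spectral_projection d b Q ->
  opnorm modC (P - Q) <= opnorm modC (a - b) / (1 - 2%:R * d).
Proof.
move=> d2 aP bQ; have [Pp _ _] := aP; have [Qp _ _] := bQ.
apply: opnorm_sub_projections => //.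
- by rewrite divr_ge0 ?(opnorm_ge0 vP) ?(ltW (gap_gt0 d2)).
- exact: opnorm_spectral_corner.
have -> : a - b = - ((1%:M - a) - (1%:M - b)) by rewrite !opprB [RHS]addrC addrA subrK.
rewrite (opnormN vP) -[X in _ *m X](subKr 1%:M).
have aP' := spectral_projection_compl aP.
exact: (opnorm_spectral_corner d2 aP' (spectral_projection_compl bQ)).
Qed.

Lemma spectral_projection_unique d a P Q : d < 2%:R^-1 ->
  spectral_projection d a P -> spectral_projection d a Q -> P = Q.
Proof.
move=> d2 aP aQ; apply/eqP; rewrite -subr_eq0; apply/eqP.
apply: (opnorm_eq0 vP) => [|x]; last exact: Normc.eq0_normc.
apply/eqP; rewrite eq_le (opnorm_ge0 vP) andbT.
by have := spectral_projection_lip d2 aP aQ; rewrite subrr (opnorm0 vP) mul0r.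
Qed.

Lemma opnorm_conj a : opnorm modC (map_mx Num.conj a) = opnorm modC a.
Proof.
have enorm_conj v : enorm modC (map_mx Num.conj v) = enorm modC v.
  by rewrite /enorm; under eq_bigr do rewrite mxE modC_conj.
have le_conj b : opnorm modC (map_mx Num.conj b) <= opnorm modC b.
  apply: (opnorm_le vP) => [|v]; first exact: (opnorm_ge0 vP).
  rewrite -(enorm_conj v) -(enorm_conj (_ *m v)) map_mxM.
  by rewrite map_conjK (opnorm_mulmx vP).
apply: le_anti; apply/andP; split; first exact: le_conj.
by have := le_conj (map_mx Num.conj a); rewrite map_conjK.
Qed.

(** With uniqueness, this makes the spectral projection of a real matrix
    real. *)
Lemma spectral_projection_conj d a P : spectral_projection d a P ->
  spectral_projection d (map_mx Num.conj a) (map_mx Num.conj P).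
Proof.
move=> [[PP Ps] Pa aP]; split; first split.
- by rewrite -map_mxM PP.
- by rewrite -[in RHS]Ps map_trmx.
- by rewrite -!map_mxM Pa.
- by rewrite -map_mxB opnorm_conj.
Qed.

Lemma opnorm_diag_le (D : 'rV[C]_n) s : 0 <= s ->
  (forall j, modC (D 0 j) <= s) -> opnorm modC (diag_mx D) <= s.
Proof.
move=> s0 Ds; apply: (opnorm_le vP) => // v.
rewrite -(@ler_pXn2r _ 2) ?nnegrE ?mulr_ge0 ?enorm_ge0 //.
rewrite exprMn !enorm_sqr mulr_sumr; apply: ler_sum => i _.
rewrite mul_diag_mx mxE (valuedM vP) exprMn ler_wpM2r ?sqr_ge0 //.
by rewrite ler_pXn2r ?nnegrE ?(valued_ge0 vP).
Qed.

(** On the range of [P] the matrix [k - P] is multiplication by [k - 1], on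
    the kernel it is multiplication by [k]. *)
Lemma enorm_shifted_projection P (k : C) s v : projectionC P -> 0 <= s ->
  s <= modC k -> s <= modC (k - 1) ->
  s * enorm modC v <= enorm modC (k *: v - P *m v).
Proof.
move=> Pp s0 sk sk1.
have -> : k *: v - P *m v =
    P *m ((k - 1) *: v) + (1%:M - P) *m (k *: v).
  rewrite mulmxBl mul1mx -!scalemxAr scalerBl scale1r.
  by rewrite [RHS]addrC addrA subrK.
rewrite -(@ler_pXn2r _ 2) ?nnegrE ?mulr_ge0 ?enorm_ge0 //.
rewrite projection_pythagoras // exprMn -(projection_decomp v Pp) mulrDr.
by apply: lerD; rewrite -exprMn ler_pXn2r ?nnegrE ?mulr_ge0 ?enorm_ge0 //
   -scalemxAr (enormZ vP) ler_wpM2r ?enorm_ge0.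
Qed.

Lemma opnorm_unitary_conj V a : V *m V ^t* = 1%:M ->
  opnorm modC (V ^t* *m a *m V) <= opnorm modC a.
Proof.
move=> VV; have VV' : V ^t* *m V = 1%:M by exact: mulmx1C.
have Vt u : enorm modC (V ^t* *m u) = enorm modC u.
  by apply: enorm_isometry; rewrite trmxCK.
apply: (opnorm_le vP); first exact: (opnorm_ge0 vP).
move=> v; rewrite -!mulmxA Vt -[in leRHS](enorm_isometry v VV').
exact: (opnorm_mulmx vP).
Qed.

(** An eigenvalue of [a], tested on a unit eigenvector, is as close to 0 or 1
    as [a] is to a projection. *)
Lemma eigenvalue_near_projection a P (k : R) d v : projectionC P ->
  opnorm modC (a - P) <= d -> enorm modC v = 1 -> a *m v = (k%:C)%C *: v ->
  `|k| <= d \/ `|k - 1| <= d.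
Proof.
move=> Pp aP v1 av; set s := Num.min `|k| `|k - 1|.
have s0 : 0 <= s by rewrite le_min !normr_ge0.
have sk : s <= modC (k%:C)%C by rewrite (valued_scal vP) ge_min lexx.
have sk1 : s <= modC ((k%:C)%C - 1).
  have -> : (k%:C)%C - 1 = ((k - 1)%:C)%C :> C by rewrite rmorphB.
  by rewrite (valued_scal vP) ge_min lexx orbT.
have := enorm_shifted_projection v Pp s0 sk sk1.
rewrite -av -mulmxBl v1 mulr1 => /le_trans/(_ (opnorm_mulmx vP _ _)).
rewrite v1 mulr1 => /le_trans/(_ aP); rewrite /s ge_min => /orP.
by [].
Qed.

(** By the previous lemma, rounding the eigenvalues of [a] to 0 or 1 moves [a]
    by at most [d]. *)
Lemma spectral_projection_exists d a P : a ^t* = a -> projectionC P ->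
  opnorm modC (a - P) <= d -> exists Q, spectral_projection d a Q.
Proof.
move=> a_sa Pp aP.
have d0 : 0 <= d by apply: le_trans aP; exact: (opnorm_ge0 vP).
have a_herm : a \is hermsymmx.
  by apply/is_hermitianmxP; rewrite expr0 scale1r a_sa.
have := hermitian_normalmx a_herm => /orthomx_spectralP.
have /mxOverP := hermitian_spectral_diag_real a_herm.
have V_unitary := spectral_unitarymx a.
rewrite invmx_unitary //; move: V_unitary.
move: (spectralmx a) (spectral_diag a) => V D /unitarymxP VV D_real aE.
have D_ReE j : D 0 j = ((complex.Re (D 0 j))%:C)%C.
  by rewrite RRe_real.
have D_near j : `|complex.Re (D 0 j)| <= d \/ `|complex.Re (D 0 j) - 1| <= d.
  (* The rows of V are conjugate to an orthonormal basis of eigenvectors. *)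
  pose w : 'cV[C]_n := V ^t* *m delta_mx j 0.
  apply: (@eigenvalue_near_projection _ _ _ _ w Pp aP).
    rewrite enorm_isometry ?trmxCK // /enorm (bigD1 j) //= mxE !eqxx.
    rewrite big1 => [|i ij]; last by rewrite mxE (negbTE ij) (valued0 vP) expr0n.
    by rewrite [modC _]Normc.normc1 expr1n addr0 sqrtr1.
  rewrite -D_ReE {1}aE /w !mulmxA -(mulmxA _ V) VV mulmx1 -mulmxA mul_diag_mx.
  rewrite scalemxAr; congr (_ *m _); apply/colP => i; rewrite !mxE.
  by case: eqP => [->|]; rewrite ?mulr0.
pose chi (k : R) : R := if `|k| <= d then 0 else 1.
have chi2 k : chi k * chi k = chi k.
  by rewrite /chi; case: ifP; rewrite ?mulr1 ?mulr0.
pose E : 'rV[C]_n := \row_j ((chi (complex.Re (D 0 j)))%:C)%C.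
have E2 : diag_mx E *m diag_mx E = diag_mx E.
  rewrite mulmx_diag; congr diag_mx.
  by apply/rowP => j; rewrite !mxE -rmorphM chi2.
have E_sa : (diag_mx E) ^t* = diag_mx E.
  rewrite tr_diag_mx map_diag_mx; congr diag_mx.
  by apply/rowP => j; rewrite !mxE; exact: conjc_real.
have conjugation (F G : 'M[C]_n) :
    (V ^t* *m F *m V) *m (V ^t* *m G *m V) = V ^t* *m (F *m G) *m V.
  by rewrite !mulmxA -(mulmxA _ V) VV mulmx1.
exists (V ^t* *m diag_mx E *m V); split; first split.
- by rewrite conjugation E2.
- by rewrite !trmxC_mul trmxCK E_sa mulmxA.
- by rewrite aE !conjugation diag_mxC.
rewrite aE -mulmxBl -mulmxBr -linearB /=.
apply: le_trans (opnorm_unitary_conj _ VV) _.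
apply: opnorm_diag_le => // j.
have -> : (D - E) 0 j = ((complex.Re (D 0 j) - chi (complex.Re (D 0 j)))%:C)%C.
  by rewrite !mxE D_ReE rmorphB.
rewrite (valued_scal vP) /chi; case: ifP => [|/negP far]; first by rewrite subr0.
by case: (D_near j).
Qed.

End Dimension.
End Complex.

(** * Continuous families of functions *)

Section Families.
Context {R : realType} {K : comPzRingType} {m : K -> R} {c : R -> K}.
Hypothesis mP : valued_by m c.
Context {n : nat} {T W : topologicalType}.
Implicit Types p : T -> W -> 'M[K]_n.

(** Continuity in the parameter is uniform over the domain, so the two
    separate variations may be added. *)
Lemma cont_family_joint (D : set W) p : cont_family m D p ->
  cont_on m (D `*` [set: T]) (fun wt => p wt.2 wt.1).
Proof.
move=> [p_cont p_unif]; apply/(cont_onP mP) => -[w s] /= [Dw _] e e0.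
have e2 : 0 < e / 2 by rewrite divr_gt0.
have near_t := (supnorm_cvg0P D s (fun t x => p t x - p s x)).1 (p_unif s) _ e2.
have near_w := (cont_onP mP D (p s)).1 (p_cont s) w Dw _ e2.
exists ([set x | D x -> opnorm m (p s x - p s w) <= e / 2],
  [set t | forall x, D x -> opnorm m (p t x - p s x) <= e / 2]) => //.
move=> -[v t] /= [pv pt] [Dv _].
rewrite (splitr e); apply: le_trans (opnorm_triangle mP (p s v) _ _) _.
by apply: lerD; [exact: pt|exact: pv].
Qed.

(** Compactness of the domain turns joint continuity into continuity for the
    supremum norm. *)
Lemma cont_joint_family p : compact [set: W] ->
  cont_on m [set: W * T] (fun wt => p wt.2 wt.1) -> cont_family m [set: W] p.
Proof.
move=> /compact_near_coveringP W_cov /(cont_onP mP) p_cont; split=> [t|s].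
  apply/(cont_onP mP) => w _ e e0.
  have [[A B] /= [wA tB] AB] := p_cont (w, t) I e e0.
  apply: filterS wA => v Av _; apply: (AB (v, t)) => //; split => //=.
  exact: nbhs_singleton.
apply/supnorm_cvg0P => e e0.
have e2 : 0 < e / 2 by rewrite divr_gt0.
apply: (W_cov _ (nbhs s) (fun t w => opnorm m (p t w - p s w) <= e)) => w _.
have [[A B] /= [wA sB] AB] := p_cont (w, s) I _ e2.
exists (A, B) => // -[v t] /= [Av Bt]; rewrite (splitr e).
apply: le_trans (opnorm_triangle mP (p s w) _ _) _.
apply: lerD; first exact: (AB (v, t)).
rewrite (opnorm_distC mP); apply: (AB (v, s)) => //; split => //=.
exact: nbhs_singleton.
Qed.

End Families.

(** * The extension constant is positive *)

(** The discrete metric on two points: a space with a function that is not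
    constant. *)
Definition two_points (R : realType) : Type := bool.

HB.instance Definition _ (R : realType) := Finite.on (two_points R).

Section TwoPoints.
Context {R : realType}.
Implicit Types x y z : two_points R.

Let dist x y : R := (x != y)%:R.

Let distxx x : dist x x = 0.
Proof. by rewrite /dist eqxx. Qed.

Let dist_positivity x y : dist x y = 0 -> x = y.
Proof. by rewrite /dist; case: eqP => // _ /eqP; rewrite oner_eq0. Qed.

Let dist_sym x y : dist x y = dist y x.
Proof. by rewrite /dist eq_sym. Qed.

Let dist_triangle y x z : dist x z <= dist x y + dist y z.
Proof.
by move: x y z => [] [] []; rewrite /dist /= ?addr0 ?add0r ?lexx ?ler01 ?addr_ge0.
Qed.

HB.instance Definition _ := isMetric.Build R (two_points R)
  distxx dist_positivity dist_sym dist_triangle.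

Lemma two_points_compact : compact [set: two_points R].
Proof. by apply: finite_compact; exact: finite_finset. Qed.

Lemma two_points_mdist x y : mdist x y = (x != y)%:R.
Proof. by []. Qed.

Lemma two_points_near x : \forall y \near x, y = x.
Proof.
have := nbhsx_ballx x 1 ltr01; apply: filterS => y.
rewrite ballEmdist /= two_points_mdist; case: eqP => [->//|_].
by rewrite ltxx.
Qed.

End TwoPoints.

(** Were [k <= 0], the extension of any Lipschitz function would be constant;
    the function equal to 1 at one of two points and 0 at the other is not. *)
Lemma extension_constant_gt0 (R : realType) (n : nat) (k : R) :
  (0 < n)%N -> extension_constant n k -> 0 < k.
Proof.
move=> n_gt0 kP; rewrite ltNge; apply/negP => k_le0.
pose F (xt : two_points R * two_points R) : 'M[R[i]]_n :=
  if xt.1 then 1%:M else 0.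
have F_sa x t : [set: two_points R] x -> F (x, t) ^t* = F (x, t).
  by rewrite /F; case: x; rewrite ?trmx1 ?trmx0 ?map_mx1 ?map_mx0.
have F_cont : cont_on (@modC R) ([set: two_points R] `*` [set: two_points R]) F.
  apply/(cont_onP modC_valued) => -[x t] _ e e0.
  exists ([set y | y = x], setT) => /=.
    by split; [exact: two_points_near|exact: filterT].
  move=> -[y s] /= [-> _] _; rewrite /F subrr (opnorm0 modC_valued).
  exact: ltW.
have F_lip t : (lip (@modC R) [set: two_points R] (fun x => F (x, t)) <= 1%:E)%E.
  apply/(lip_leP modC_valued) => // x y _ _.
  rewrite mul1r two_points_mdist.
  have norm1 : opnorm (@modC R) (1%:M : 'M[R[i]]_n) <= 1.
    by apply: (opnorm_le modC_valued) => // v; rewrite mul1mx mul1r.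
  move: x y => [] []; rewrite /F /=.
  - by rewrite subrr (opnorm0 modC_valued).
  - by rewrite subr0; exact: norm1.
  - by rewrite sub0r (opnormN modC_valued); exact: norm1.
  - by rewrite subrr (opnorm0 modC_valued).
have [G [_ _ GF G_lip _]] := kP _ _ _ F 1 two_points_compact closedT
  two_points_compact F_sa F_cont F_lip.
have G_lip0 : (lip (@modC R) [set: two_points R]
    (fun x => G (x, true : two_points R)) <= 0%:E)%E.
  by apply: le_trans (G_lip _) _; rewrite mulr1 lee_fin.
have := (lip_leP modC_valued _ _ (lexx 0)).1 G_lip0 true false I I.
rewrite mul0r !GF // /F subr0 => /= norm1_le0.
have /matrixP/(_ (Ordinal n_gt0) (Ordinal n_gt0)) : 1%:M = 0 :> 'M[R[i]]_n.
  apply: (opnorm_eq0 modC_valued) => [|x]; last exact: Normc.eq0_normc.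
  by apply: le_anti; rewrite norm1_le0 (opnorm_ge0 modC_valued).
by rewrite !mxE eqxx => /eqP; rewrite oner_eq0.
Qed.

(** * Rounding an extension to projections *)

(** Each value of [H] is within [d = eps L] of a projection.  The rounded
    family has Lipschitz constant at most [L / (1 - 2 d)], and the inequality
    is strict because [2 d < 12 d].  The last clause, that real matrices are
    rounded to real matrices, serves the case of real scalars. *)
Lemma round_extension (R : realType) (Z : metricType R) (X : set Z)
    (T : topologicalType) (n : nat) (L eps : R) (H : T -> Z -> 'M[R[i]]_n) :
  compact [set: Z] -> dense_within X eps -> 0 < L -> 0 < eps ->
  eps * L < 1 / 12%:R ->
  (forall t z, (H t z) ^t* = H t z) ->
  (forall t x, X x -> projectionC (H t x)) ->
  cont_on (@modC R) [set: Z * T] (fun zt => H zt.2 zt.1) ->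
  (forall t, (lip (@modC R) [set: Z] (H t) <= L%:E)%E) ->
  exists q : T -> Z -> 'M[R[i]]_n,
    [/\ cont_family (@modC R) [set: Z] q,
        forall t z, projectionC (q t z),
        forall t x, X x -> q t x = H t x,
        forall t, (lip (@modC R) [set: Z] (q t)
                    < (L * (1 - 12%:R * (eps * L))^-1)%:E)%E
      & forall t z, map_mx Num.conj (H t z) = H t z ->
          map_mx Num.conj (q t z) = q t z].
Proof.
have vP := @modC_valued R.
move=> Zcompact Xdense L0 eps0 small H_sa H_proj H_cont H_lip.
set d := eps * L in small *.
have d0 : 0 < d by rewrite mulr_gt0.
have d2 : d < 2%:R^-1 by lra.
have dist_le t y z : opnorm (@modC R) (H t y - H t z) <= L * mdist y z.
  exact: (lip_leP vP _ _ (ltW L0)).1 (H_lip t) _ _ I I.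
have near_proj t z : exists P, spectral_projection d (H t z) P.
  have [x Xx zx] := Xdense z.
  apply: (spectral_projection_exists (H_sa t z) (H_proj t x Xx)).
  apply: le_trans (dist_le t z x) _.
  by rewrite /d [eps * L]mulrC ler_wpM2l // ltW.
have [q qP] : exists q : T -> Z -> 'M[R[i]]_n,
    forall t z, spectral_projection d (H t z) (q t z).
  exists (fun t z => sval (cid (near_proj t z))) => t z.
  by case: cid.
have q_le s t y z : opnorm (@modC R) (q s y - q t z) <=
    opnorm (@modC R) (H s y - H t z) / (1 - 2%:R * d).
  exact: (spectral_projection_lip d2 (qP s y) (qP t z)).
have gap := gap_gt0 d2.
have C0 : 0 <= L / (1 - 2%:R * d) by rewrite divr_ge0 // ltW.
exists q; split.
- apply: (cont_joint_family vP Zcompact); apply/(cont_onP vP) => zt _ e e0.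
  have eg : 0 < e * (1 - 2%:R * d) by rewrite mulr_gt0.
  have /(cont_onP vP)/(_ zt I _ eg) := H_cont.
  apply: filterS => zt' /(_ I) H_le _; apply: le_trans (q_le _ _ _ _) _.
  by rewrite ler_pdivrMr.
- by move=> t z; case: (qP t z).
- (* A projection is its own spectral projection. *)
  move=> t x Xx; apply: (spectral_projection_unique d2 (qP t x)).
  split; [exact: H_proj|by []|].
  by rewrite subrr (opnorm0 vP) ltW.
- move=> t; apply: (@le_lt_trans _ _ (L / (1 - 2%:R * d))%:E).
    apply/(lip_leP vP) => // y z _ _; apply: le_trans (q_le _ _ _ _) _.
    by rewrite [leRHS]mulrAC ler_pM2r ?invr_gt0.
  have gap12 : 0 < 1 - 12%:R * d by clear -small; lra.
  rewrite lte_fin ltr_pM2l // ltf_pV2 ?posrE //.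
  by clear -d0; lra.
- move=> t z H_real; apply: (spectral_projection_unique d2 _ (qP t z)).
  by rewrite -[in X in _ X _]H_real; exact: spectral_projection_conj.
Qed.

(** * Real matrices as complex matrices *)

Section RealMatrices.
Context {R : realType}.
Local Notation C := R[i].
Local Notation modC := (@modC R).
Local Notation modR := (@modR R).
Local Notation vC := modC_valued.
Local Notation vR := modR_valued.

Definition cplx_mx {m n} (a : 'M[R]_(m, n)) : 'M[C]_(m, n) :=
  map_mx (real_complex R) a.

Definition re_mx {m n} (a : 'M[C]_(m, n)) : 'M[R]_(m, n) :=
  map_mx (@complex.Re R) a.

Definition im_mx {m n} (a : 'M[C]_(m, n)) : 'M[R]_(m, n) :=
  map_mx (@complex.Im R) a.

Lemma cplx_mxK m n : cancel (@cplx_mx m n) re_mx.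
Proof. by move=> a; apply/matrixP => i j; rewrite !mxE. Qed.

Lemma re_mxK m n (a : 'M[C]_(m, n)) :
  map_mx Num.conj a = a -> cplx_mx (re_mx a) = a.
Proof.
move=> /matrixP a_real; apply/matrixP => i j; have := a_real i j.
rewrite !mxE; case: (a i j) => x y [] /eqP; rewrite eqNr => /eqP ->.
by [].
Qed.

Lemma cplx_mxB m n (a b : 'M[R]_(m, n)) :
  cplx_mx (a - b) = cplx_mx a - cplx_mx b.
Proof. exact: map_mxB. Qed.

Lemma re_mxB m n (a b : 'M[C]_(m, n)) : re_mx (a - b) = re_mx a - re_mx b.
Proof.
apply/matrixP => i j; rewrite !mxE.
by case: (a i j) (b i j) => [x y] [x' y'].
Qed.

Lemma trmxC_cplx m n (a : 'M[R]_(m, n)) : (cplx_mx a) ^t* = cplx_mx a^T.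
Proof. by apply/matrixP => i j; rewrite !mxE; exact: conjc_real. Qed.

Lemma conj_cplx m n (a : 'M[R]_(m, n)) :
  map_mx Num.conj (cplx_mx a) = cplx_mx a.
Proof. by apply/matrixP => i j; rewrite !mxE; exact: conjc_real. Qed.

Lemma re_mx_sa n (a : 'M[C]_n) : a ^t* = a -> (re_mx a)^T = re_mx a.
Proof.
move=> /matrixP a_sa; apply/matrixP => i j; have := a_sa i j.
by rewrite !mxE; case: (a j i) => x y <-.
Qed.

Lemma projectionC_cplx n (a : 'M[R]_n) :
  projectionC (cplx_mx a) <-> projectionR a.
Proof.
split=> -[aa a_sa]; split.
- by apply: (can_inj (@cplx_mxK _ _)); rewrite /cplx_mx map_mxM.
- by apply: (can_inj (@cplx_mxK _ _)); rewrite -trmxC_cplx.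
- by rewrite -map_mxM aa.
- by rewrite trmxC_cplx a_sa.
Qed.

Lemma enorm_cplx n (v : 'cV[R]_n) : enorm modC (cplx_mx v) = enorm modR v.
Proof.
rewrite /enorm; congr Num.sqrt; apply: eq_bigr => i _.
by rewrite mxE (valued_scal vC).
Qed.

Lemma enorm_re_im n (v : 'cV[C]_n) :
  enorm modC v ^+ 2 = enorm modR (re_mx v) ^+ 2 + enorm modR (im_mx v) ^+ 2.
Proof.
rewrite !enorm_sqr -big_split /=; apply: eq_bigr => i _; rewrite !mxE.
case: (v i 0) => x y; rewrite /Defs.modC /Defs.modR /=.
by rewrite sqr_sqrtr ?addr_ge0 ?sqr_ge0 // !real_normK ?num_real.
Qed.

Lemma Re_sum (I : finType) (F : I -> C) :
  complex.Re (\sum_i F i) = \sum_i complex.Re (F i).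
Proof. by apply: (big_morph (@complex.Re R)) => // -[x y] [x' y']. Qed.

Lemma Im_sum (I : finType) (F : I -> C) :
  complex.Im (\sum_i F i) = \sum_i complex.Im (F i).
Proof. by apply: (big_morph (@complex.Im R)) => // -[x y] [x' y']. Qed.

Lemma re_mxM n (a : 'M[R]_n) (v : 'cV[C]_n) :
  re_mx (cplx_mx a *m v) = a *m re_mx v.
Proof.
apply/colP => i; rewrite !mxE Re_sum; apply: eq_bigr => j _; rewrite !mxE.
by case: (v j 0) => x y /=; rewrite mul0r subr0.
Qed.

Lemma im_mxM n (a : 'M[R]_n) (v : 'cV[C]_n) :
  im_mx (cplx_mx a *m v) = a *m im_mx v.
Proof.
apply/colP => i; rewrite !mxE Im_sum; apply: eq_bigr => j _; rewrite !mxE.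
by case: (v j 0) => x y /=; rewrite mul0r addr0.
Qed.

Lemma re_mxM_cplx n (a : 'M[C]_n) (v : 'cV[R]_n) :
  re_mx (a *m cplx_mx v) = re_mx a *m v.
Proof.
apply/colP => i; rewrite !mxE Re_sum; apply: eq_bigr => j _; rewrite !mxE.
by case: (a i j) => x y /=; rewrite mulr0 subr0.
Qed.

(** A real matrix acts separately on real and imaginary parts, so complex
    vectors do not increase its norm. *)
Lemma opnorm_cplx n (a : 'M[R]_n) : opnorm modC (cplx_mx a) = opnorm modR a.
Proof.
apply: le_anti; apply/andP; split.
  apply: (opnorm_le vC) => [|v]; first exact: (opnorm_ge0 vR).
  have N0 := opnorm_ge0 vR a.
  rewrite -(@ler_pXn2r _ 2) ?nnegrE ?mulr_ge0 ?enorm_ge0 //.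
  rewrite exprMn !enorm_re_im re_mxM im_mxM mulrDr -!exprMn.
  by apply: lerD; rewrite ler_pXn2r ?nnegrE ?mulr_ge0 ?enorm_ge0 //;
    exact: (opnorm_mulmx vR).
apply: (opnorm_le vR) => [|v]; first exact: (opnorm_ge0 vC).
rewrite -!enorm_cplx /cplx_mx map_mxM; exact: (opnorm_mulmx vC).
Qed.

(** On a real vector [v], the real part of [a] yields the real part of [a v],
    which is no longer than [a v]. *)
Lemma opnorm_re n (a : 'M[C]_n) : opnorm modR (re_mx a) <= opnorm modC a.
Proof.
apply: (opnorm_le vR) => [|v]; first exact: (opnorm_ge0 vC).
rewrite -re_mxM_cplx -[enorm _ v]enorm_cplx.
apply: le_trans (opnorm_mulmx vC _ _).
rewrite -(@ler_pXn2r _ 2) ?nnegrE ?enorm_ge0 //.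
by rewrite enorm_re_im lerDl sqr_ge0.
Qed.

Lemma lip_cplx (n : nat) (W : metricType R) (D : set W) (a : W -> 'M[R]_n) :
  lip modC D (fun w => cplx_mx (a w)) = lip modR D a.
Proof.
rewrite /lip; congr (ereal_sup (_ `|` _)); apply: eq_imagel => xy _.
by rewrite -cplx_mxB opnorm_cplx.
Qed.

Lemma cont_family_cplx (n : nat) (T W : topologicalType) (D : set W)
    (p : T -> W -> 'M[R]_n) :
  cont_family modC D (fun t w => cplx_mx (p t w)) <-> cont_family modR D p.
Proof.
have E a b : opnorm modC (cplx_mx a - cplx_mx b) = opnorm modR (a - b).
  by rewrite -cplx_mxB opnorm_cplx.
split=> -[p_cont p_unif]; split=> [t|s].
- apply/(cont_onP vR) => w Dw e e0.
  have := (cont_onP vC _ _).1 (p_cont t) w Dw e e0.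
  by apply: filterS => v; rewrite E.
- apply/supnorm_cvg0P => e e0.
  have := (supnorm_cvg0P D s (fun t w => _)).1 (p_unif s) e e0.
  by apply: filterS => t p_le w Dw; rewrite -E; exact: p_le.
- apply/(cont_onP vC) => w Dw e e0.
  have := (cont_onP vR _ _).1 (p_cont t) w Dw e e0.
  by apply: filterS => v; rewrite E.
- apply/supnorm_cvg0P => e e0.
  have := (supnorm_cvg0P D s (fun t w => _)).1 (p_unif s) e e0.
  by apply: filterS => t p_le w Dw; rewrite E; exact: p_le.
Qed.

End RealMatrices.

Theorem theorem6p2 (R : realType) (Z : metricType R) (X : set Z)
    (T : topologicalType) (n : nat) (lambda N eps : R)
    (Zcompact : compact [set: Z]) (Xclosed : closed X) (Xnonempty : X !=set0)
    (n_gt0 : (0 < n)%N) (Tcompact : compact [set: T])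
    (lambdaP : is_lambda n lambda)
    (N_gt0 : 0 < N) (eps_gt0 : 0 < eps)
    (Xdense : dense_within X eps)
    (small : eps * lambda * N < 1 / 12%:R) :
  (forall p : T -> Z -> 'M[R[i]]_n,
     cont_family modC X p ->
     (forall t x, X x -> projectionC (p t x)) ->
     (forall t, (lip modC X (p t) <= N%:E)%E) ->
     exists q : T -> Z -> 'M[R[i]]_n,
       cont_family modC [set: Z] q /\
       forall t,
         [/\ forall z, projectionC (q t z),
             forall x, X x -> q t x = p t x
           & (lip modC [set: Z] (q t)
                < (lambda * N * (1 - 12%:R * eps * lambda * N)^-1)%:E)%E])
  /\
  (forall p : T -> Z -> 'M[R]_n,
     cont_family modR X p ->
     (forall t x, X x -> projectionR (p t x)) ->
     (forall t, (lip modR X (p t) <= N%:E)%E) ->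
     exists q : T -> Z -> 'M[R]_n,
       cont_family modR [set: Z] q /\
       forall t,
         [/\ forall z, projectionR (q t z),
             forall x, X x -> q t x = p t x
           & (lip modR [set: Z] (q t)
                < (lambda * N * (1 - 12%:R * eps * lambda * N)^-1)%:E)%E]).
Proof.
have vP := @modC_valued R.
have [lambda_ext _] := lambdaP.
have lambda_gt0 := extension_constant_gt0 n_gt0 lambda_ext.
set L := lambda * N.
have L_gt0 : 0 < L by rewrite mulr_gt0.
have epsL : eps * L < 1 / 12%:R by rewrite mulrA.
have -> : L * (1 - 12%:R * eps * lambda * N)^-1 =
    L * (1 - 12%:R * (eps * L))^-1 by rewrite /L !mulrA.
have extend (p : T -> Z -> 'M[R[i]]_n) : cont_family (@modC R) X p ->
    (forall t x, X x -> projectionC (p t x)) ->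
    (forall t, (lip (@modC R) X (p t) <= N%:E)%E) ->
    exists H : T -> Z -> 'M[R[i]]_n,
      [/\ forall t z, (H t z) ^t* = H t z,
          forall t x, X x -> H t x = p t x,
          cont_on (@modC R) [set: Z * T] (fun zt => H zt.2 zt.1)
        & forall t, (lip (@modC R) [set: Z] (H t) <= L%:E)%E].
  move=> p_cont p_proj p_lip.
  have p_sa x t : X x -> (p (x, t).2 (x, t).1) ^t* = p (x, t).2 (x, t).1.
    by move=> Xx; case: (p_proj t x Xx).
  have [G [G_sa G_cont Gp G_lip _]] := lambda_ext _ _ _
    (fun zt => p zt.2 zt.1) N Zcompact Xclosed Tcompact p_sa
    (cont_family_joint vP p_cont) p_lip.
  exists (fun t z => G (z, t)); split.
  - by move=> t z; exact: G_sa.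
  - by move=> t x Xx; exact: (Gp x t Xx).
  - have -> : (fun zt : Z * T => G (zt.1, zt.2)) = G by apply/funext => -[].
    exact: G_cont.
  - exact: G_lip.
split=> p p_cont p_proj p_lip.
- have [H [H_sa Hp H_cont H_lip]] := extend p p_cont p_proj p_lip.
  have H_proj t x : X x -> projectionC (H t x).
    by move=> Xx; rewrite (Hp t x Xx); exact: p_proj.
  have [q [q_cont q_proj qH q_lip _]] := round_extension Zcompact Xdense L_gt0
    eps_gt0 epsL H_sa H_proj H_cont H_lip.
  exists q; split; first exact: q_cont.
  move=> t; split; [exact: q_proj| |exact: q_lip].
  by move=> x Xx; rewrite (qH t x Xx) (Hp t x Xx).
- have pC_proj t x : X x -> projectionC (cplx_mx (p t x)).
    by move=> Xx; apply/projectionC_cplx; exact: p_proj.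
  have pC_lip t : (lip (@modC R) X (fun x => cplx_mx (p t x)) <= N%:E)%E.
    by rewrite lip_cplx.
  have [G [G_sa Gp G_cont G_lip]] := extend (fun t x => cplx_mx (p t x))
    ((cont_family_cplx X p).2 p_cont) pC_proj pC_lip.
  (* The extension constant concerns complex matrices, so [G] need not be
     real; its real part is. *)
  pose H t z := cplx_mx (re_mx (G t z)).
  have H_le s t y z : opnorm (@modC R) (H s y - H t z) <=
      opnorm (@modC R) (G s y - G t z).
    by rewrite -cplx_mxB -re_mxB opnorm_cplx opnorm_re.
  have H_sa t z : (H t z) ^t* = H t z by rewrite trmxC_cplx re_mx_sa.
  have Hp t x : X x -> H t x = cplx_mx (p t x).
    by move=> Xx; rewrite /H (Gp t x Xx) cplx_mxK.
  have H_proj t x : X x -> projectionC (H t x).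
    by move=> Xx; rewrite (Hp t x Xx); exact: pC_proj.
  have H_cont : cont_on (@modC R) [set: Z * T] (fun zt => H zt.2 zt.1).
    apply/(cont_onP vP) => zt _ e e0.
    have := (cont_onP vP _ _).1 G_cont zt I e e0.
    by apply: filterS => zt' /(_ I) G_le _; apply: le_trans (H_le _ _ _ _) G_le.
  have H_lip t : (lip (@modC R) [set: Z] (H t) <= L%:E)%E.
    apply/(lip_leP vP _ _ (ltW L_gt0)) => y z _ _.
    apply: le_trans (H_le _ _ _ _) _.
    exact: ((lip_leP vP _ _ (ltW L_gt0)).1 (G_lip t) y z I I).
  have [q [q_cont q_proj qH q_lip q_real]] := round_extension Zcompact Xdense
    L_gt0 eps_gt0 epsL H_sa H_proj H_cont H_lip.
  have qE t z : cplx_mx (re_mx (q t z)) = q t z.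
    by apply/re_mxK/q_real; exact: conj_cplx.
  exists (fun t z => re_mx (q t z)); split.
    apply/cont_family_cplx.
    have -> : (fun t z => cplx_mx (re_mx (q t z))) = q.
      by apply/funext => t; apply/funext => z; exact: qE.
    exact: q_cont.
  move=> t; split=> [z|x Xx|].
  + by apply/projectionC_cplx; rewrite qE.
  + by rewrite (qH t x Xx) (Hp t x Xx) cplx_mxK.
  + rewrite -lip_cplx; have -> : (fun z => cplx_mx (re_mx (q t z))) = q t.
      by apply/funext => z; exact: qE.
    exact: q_lip.
Qed.
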